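(* Let $K$ be a connected isolated non-saddle set of a flow on the $n$-dimensional torus $T^n$. Then the complexity of the region of influence $\mathcal{I}(K)$ is at most $1$.
   Context: For a flow $\varphi$ on $M$ write $xt=\varphi(x,t)$, and $\omega(x)=\bigcap_{t>0}\overline{x[t,\infty)}$, $\omega^*(x)=\bigcap_{t>0}\overline{x(-\infty,-t]}$. A compact invariant set $K$ is isolated if it has a compact neighborhood $N$ (isolating neighborhood) such that $K$ is the maximal invariant set in $N$; isolated invariant sets are assumed to be non-empty proper subsets of $M$. For such $N$ put $N^+=\{x\in N: x[0,\infty)\subset N\}$, $N^-=\{x\in N: x(-\infty,0]\subset N\}$. An isolating block is an isolating neighborhood $N$ for which there are compact sets $N^i,N^o\subset\partial N$ with: (1) $\partial N=N^i\cup N^o$; (2) for every $x\in N^i$ there is $\varepsilon>0$ with $x[-\varepsilon,0)\subset M\setminus N$, and for every $x\in N^o$ there is $\delta>0$ with $x(0,\delta]\subset M\setminus N$; (3) for every $x\in\partial N\setminus N^i$ there is $\varepsilon>0$ with $x[-\varepsilon,0)\subset\mathring N$, and for every $x\in\partial N\setminus N^o$ there is $\delta>0$ with $x(0,\delta]\subset\mathring N$. An invariant compactum $K$ is saddle if there is a neighborhood $U$ of $K$ such that every neighborhood $V$ of $K$ contains a point $x$ with $x[0,\infty)\not\subset U$ and $x(-\infty,0]\not\subset U$; otherwise $K$ is non-saddle. Isolated non-saddle sets admit isolating blocks of the form $N=N^+\cup N^-$. Let $W^s(K)=\{x\in M:\emptyset\neq\omega(x)\subset K\}$ and $W^u(K)=\{x\in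 M:\emptyset\neq\omega^*(x)\subset K\}$. The region of influence of $K$ is $\mathcal{I}(K)=W^s(K)\cup W^u(K)$, an open set. $K$-ends and complexity: if $N,N'$ are isolating blocks of $K$ of the form $N=N^+\cup N^-$, $N'=N'^+\cup N'^-$, a component $N_1$ of $N\setminus K$ and a component $N_1'$ of $N'\setminus K$ are related if there is $T\in\mathbb{R}$ with $N_1T\subset N_1'$; this is an equivalence relation on the components of the sets $N\setminus K$, with $N$ ranging over all such blocks, and its classes are called the $K$-ends of $\mathcal{I}(K)\setminus K$. For a fixed block $N=N^+\cup N^-$, every $K$-end is represented by exactly one component of $N\setminus K$, there are finitely many $K$-ends, and all representatives of a $K$-end lie in the same component of $\mathcal{I}(K)\setminus K$. The complexity of $\mathcal{I}(K)$ is $\mathfrak{c}=k-m$, where $k$ is the number of $K$-ends and $m$ the number of components of $\mathcal{I}(K)\setminus K$. *)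

(* Defs.v *)
From HB Require Import structures.
From mathcomp Require Import all_boot all_order all_algebra.
From mathcomp Require Import all_classical all_reals all_analysis.
Set Implicit Arguments.
Unset Strict Implicit.
Unset Printing Implicit Defensive.
Import Order.TTheory GRing.Theory Num.Theory.
Import numFieldNormedType.Exports.
Local Open Scope classical_set_scope.
Local Open Scope ring_scope.

Section Torus.
Context (R : realType) (n : nat).

(* Congruence modulo Z^n. *)
Definition torus_rel (x y : 'rV[R]_n) : bool :=
  [forall i, (x - y) ord0 i \is a Num.int].

Lemma torus_rel_refl : reflexive torus_rel.
Proof. by move=> x; apply/forallP => i; rewrite subrr mxE rpred0. Qed.

Lemma torus_rel_sym : symmetric torus_rel.
Proof.
move=> x y; apply/forallP/forallP => h i; have := h i;
  by rewrite -opprB mxE rpredN.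
Qed.

Lemma torus_rel_trans : transitive torus_rel.
Proof.
move=> y x z /forallP xy /forallP yz; apply/forallP => i.
by rewrite -(subrKA y) mxE rpredD.
Qed.

Canonical torus_equiv_rel : equiv_rel 'rV[R]_n :=
  EquivRel torus_rel torus_rel_refl torus_rel_sym torus_rel_trans.

(* T^n = R^n / Z^n with the quotient topology. *)
Definition torus : Type := quotient_topology {eq_quot torus_equiv_rel}%qT.

HB.instance Definition _ :=
  Topological.copy torus (quotient_topology {eq_quot torus_equiv_rel}%qT).
HB.instance Definition _ :=
  Quotient.copy torus (quotient_topology {eq_quot torus_equiv_rel}%qT).

End Torus.

Section Topology.
Context {M : topologicalType}.

Definition boundary (A : set M) : set M := closure A `\` interior A.

Definition components (A : set M) : set (set M) := connected_component A @` A.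

End Topology.

Section Flow.
Context {R : realType} {M : topologicalType}.

(* [phi x t] is written xt in the mathematical notation, and
   [phi x @` I] is xI for a set I of times. *)
Definition is_flow (phi : M -> R -> M) : Prop :=
  [/\ continuous (fun p : M * R => phi p.1 p.2),
      forall x, phi x 0 = x &
      forall x s t, phi (phi x s) t = phi x (s + t)].

Variable phi : M -> R -> M.

Definition omega (x : M) : set M :=
  \bigcap_(t in [set t : R | 0 < t]) closure (phi x @` `[t, +oo[).

Definition omega_star (x : M) : set M :=
  \bigcap_(t in [set t : R | 0 < t]) closure (phi x @` `]-oo, - t]).

Definition invariant_set (A : set M) : Prop :=
  forall x t, A x -> A (phi x t).

Definition maximal_invariant_in (N K : set M) : Prop :=
  [/\ K `<=` N, invariant_set K &
      forall A, A `<=` N -> invariant_set A -> A `<=` K].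

Definition isolating_nbhd (K N : set M) : Prop :=
  [/\ compact N, set_nbhs K N & maximal_invariant_in N K].

Definition isolated_invariant (K : set M) : Prop :=
  [/\ compact K, invariant_set K, K !=set0, K <> setT &
      exists N, isolating_nbhd K N].

Definition positive_part (N : set M) : set M :=
  [set x | N x /\ phi x @` `[0, +oo[ `<=` N].

Definition negative_part (N : set M) : set M :=
  [set x | N x /\ phi x @` `]-oo, 0] `<=` N].

Definition isolating_block (K N : set M) : Prop :=
  isolating_nbhd K N /\
  exists Ni No : set M,
    [/\ [/\ compact Ni, compact No & boundary N = Ni `|` No],
        forall x, Ni x ->
          exists2 e : R, 0 < e & phi x @` `[- e, 0[ `<=` ~` N,
        forall x, No x ->
          exists2 d : R, 0 < d & phi x @` `]0, d] `<=` ~` N,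
        forall x, (boundary N `\` Ni) x ->
          exists2 e : R, 0 < e & phi x @` `[- e, 0[ `<=` interior N &
        forall x, (boundary N `\` No) x ->
          exists2 d : R, 0 < d & phi x @` `]0, d] `<=` interior N].

Definition saddle (K : set M) : Prop :=
  exists2 U, set_nbhs K U &
    forall V, set_nbhs K V ->
      exists x, [/\ V x, ~ (phi x @` `[0, +oo[ `<=` U) &
                         ~ (phi x @` `]-oo, 0] `<=` U)].

Definition stable_set (K : set M) : set M :=
  [set x | omega x !=set0 /\ omega x `<=` K].

Definition unstable_set (K : set M) : set M :=
  [set x | omega_star x !=set0 /\ omega_star x `<=` K].

Definition region_of_influence (K : set M) : set M :=
  stable_set K `|` unstable_set K.

(* The isolating blocks of the form N = N^+ U N^-. *)
Definition nonsaddle_block (K N : set M) : Prop :=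
  isolating_block K N /\ N = positive_part N `|` negative_part N.

Definition block_components (K : set M) : set (set M) :=
  \bigcup_(N in nonsaddle_block K) components (N `\` K).

Definition end_related (C D : set M) : Prop :=
  exists T : R, (phi^~ T) @` C `<=` D.

(* A K-end is an equivalence class of block components. *)
Definition K_ends (K : set M) : set (set (set M)) :=
  (fun C => [set D | block_components K D /\ end_related C D])
    @` block_components K.

(* Stated as a relation so that the complexity only makes sense when both
   cardinals are finite. *)
Definition is_complexity (K : set M) (c : int) : Prop :=
  exists k m : nat,
    [/\ (K_ends K #= `I_k)%card,
        (components (region_of_influence K `\` K) #= `I_m)%card &
        c = k%:Z - m%:Z].

End Flow.

(* Main.v *)
(* Let P (resp. Q) be the set of the points outside K attracted by K in positive
   (resp. negative) time. Both are open, and by uniform attraction the K-ends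
   embed into the disjoint union of the components of P and of those of Q. As the
   components of I(K) \ K are obtained by gluing those of P and Q along the
   homoclinic points, i.e. along P n Q, it suffices that all homoclinic points
   lie in one component of P and in one component of Q.

   On the torus this follows from the commutativity of Z^n. Suppose that x1 and x2
   are homoclinic and lie in distinct components A1 and A2 of P. Consider the
   Cech cocycle on the torus, with values in a nonabelian group, equal to a when
   K is entered from A1, to b when it is entered from A2, and to 1 otherwise. It
   is a coboundary on R^n, and the deck transformations act on the solution by a
   homomorphism from Z^n, so that its monodromy is abelian. But the monodromy
   contains a and b, up to a common conjugation, since the orbits of x1 and x2
   leave K and come back to it through A1 and A2 respectively. *)
Require Import Defs.
From HB Require Import structures.
From mathcomp Require Import all_boot all_order all_algebra.
From mathcomp Require Import all_fingroup.
From mathcomp Require Import all_classical all_reals all_analysis.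
From mathcomp Require Import lra.
Set Implicit Arguments.
Unset Strict Implicit.
Unset Printing Implicit Defensive.
Import Order.TTheory GRing.Theory Num.Theory.
Import numFieldNormedType.Exports.
Local Open Scope classical_set_scope.
Local Open Scope ring_scope.

Definition locally_connected (M : topologicalType) : Prop :=
  forall (p : M) U, nbhs p U ->
    exists2 C, nbhs p C & connected C /\ C `<=` U.

(** * Group-valued cocycles on R^n *)

(** The fibre of [f] through [x] is relatively open and closed in [A]. No structure is put on [U],
    so that [f] may be a predicate. *)
Lemma locally_constant_connected (T : topologicalType) (U : Type) (A : set T)
    (f : T -> U) (x y : T) : connected A ->
  (forall z, A z -> \forall w \near z, A w -> f w = f z) ->
  A x -> A y -> f x = f y.
Proof.
move=> cA fA Ax Ay.
pose B := A `&` [set z | f z = f x].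
suff BA : B = A by move: Ay; rewrite -BA => -[_ ->].
apply: cA; first by exists x.
- exists [set z | A z -> f z = f x]°; first exact: open_interior.
  apply/seteqP; split => z [Az fz]; split => //.
    rewrite /interior/=; have := fA z Az; apply: filterS => w + Aw.
    by move=> /(_ Aw) ->.
  exact: (nbhs_singleton fz).
- exists (~` [set z | A z -> f z <> f x]°).
    exact/open_closedC/open_interior.
  apply/seteqP; split => z [Az fz]; split => //.
    by move=> /nbhs_singleton /(_ Az).
  apply: contrapT => fzx; apply: fz; rewrite /interior/=.
  by have := fA z Az; apply: filterS => w + Aw => /(_ Aw) ->.
Qed.

Section Potential.
Context {T : topologicalType} {G : groupType}.
Implicit Types (theta : T -> T -> G) (X Y : set T) (s : T -> G).

(** A 0-cochain whose coboundary is the nonabelian cocycle [theta]. Only the germ of [theta x] at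
    [x] matters, so that no open cover has to be carried along. *)
Definition potential theta X s :=
  forall x, X x -> \forall y \near x, X y -> (s y * theta x y)%g = s x.

Lemma potential_sub theta X Y s :
  X `<=` Y -> potential theta Y s -> potential theta X s.
Proof.
move=> XY sY x Xx; have := sY x (XY _ Xx).
by apply: filterS => y + /XY Yy; apply.
Qed.

Lemma potentialMl theta X s (c : G) :
  potential theta X s -> potential theta X (fun x => c * s x)%g.
Proof.
move=> sX x Xx; have := sX x Xx.
by apply: filterS => y + Xy; rewrite -mulgA => /(_ Xy) ->.
Qed.

(** In the quotient [s' x * (s x)^-1] the factor [theta] cancels, so the quotient is locally
    constant. Two potentials thus differ by a constant left factor. *)
Lemma potential_unique theta X s s' x y : connected X ->
  potential theta X s -> potential theta X s' -> X x -> X y ->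
  (s' x * (s x)^-1 = s' y * (s y)^-1)%g.
Proof.
move=> cX sX s'X.
apply: (@locally_constant_connected _ _ X (fun x => s' x * (s x)^-1)%g) => //.
move=> z Xz; have := s'X z Xz; have := sX z Xz; apply: filterS2 => w sw s'w Xw.
by rewrite -sw// -s'w// invMg mulgA mulgK.
Qed.

(** A van Kampen type gluing: a left factor makes the potentials agree at one point of the overlap,
    hence on the whole overlap, which is connected. *)
Lemma potential_glue theta X Y s s' : closed X -> closed Y ->
  connected (X `&` Y) -> X `&` Y !=set0 ->
  potential theta X s -> potential theta Y s' ->
  exists t, potential theta (X `|` Y) t.
Proof.
move=> clX clY cXY [p XYp] sX s'Y.
pose s2 x := (s p * (s' p)^-1 * s' x)%g.
have s2Y : potential theta Y s2 by exact: potentialMl.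
have s2E x : X x -> Y x -> s2 x = s x.
  move=> Xx Yx.
  have := @potential_unique theta (X `&` Y) s' s p x cXY
    (potential_sub (@subIsetr _ _ _) s'Y) (potential_sub (@subIsetl _ _ _) sX)
    XYp (conj Xx Yx).
  by rewrite /s2 => ->; rewrite mulgVK.
pose t x := if pselect (X x) then s x else s2 x.
have tX x : X x -> t x = s x by rewrite /t; case: pselect.
have tY x : Y x -> t x = s2 x.
  by rewrite /t; case: pselect => // Xx Yx; rewrite s2E.
(* By closedness, [Z] has points arbitrarily near [x] only if [x] is in [Z]; so the condition on [u]
   makes sense at every point of the space. *)
have near_closed (Z : set T) (u : T -> G) x : closed Z -> potential theta Z u ->
    \forall y \near x, Z y -> Z x /\ (u y * theta x y)%g = u x.
  move=> clZ uZ; have [Zx|nZx] := pselect (Z x).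
    by have := uZ x Zx; apply: filterS => y h Zy; split => //; exact: h.
  have : nbhs x (~` Z) by apply: open_nbhs_nbhs; split => //; exact: closed_openC.
  by apply: filterS.
exists t => x _; near=> y => -[Xy|Yy].
  have [Xx e] : X x /\ (s y * theta x y)%g = s x.
    by move: Xy; near: y; exact: near_closed.
  by rewrite !tX.
have [Yx e] : Y x /\ (s2 y * theta x y)%g = s2 x.
  by move: Yy; near: y; exact: near_closed.
by rewrite !tY.
Unshelve. all: by end_near. Qed.

(** The inverse of [theta x] is a potential on the set of the [y] at which the cocycle identity
    holds near [y]. *)
Lemma cocycle_potential theta x :
  (\forall y \near x, \forall z \near y,
     theta x z = (theta y z * theta x y)%g) ->
  exists2 U, nbhs x U & exists s, potential theta U s.
Proof.
move=> h; eexists; first exact: h.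
exists (fun y => (theta x y)^-1)%g => y /= Uy; have := Uy.
by apply: filterS => z -> _; rewrite invMg mulgVK.
Qed.

End Potential.

(** * Potentials on boxes and on all of R^n *)

Section Box.
Context {R : realType} {n : nat}.
Implicit Types (a b : 'I_n -> R) (x y : 'rV[R]_n).

Definition box a b : set 'rV[R]_n :=
  [set x | forall i, `[a i, b i]%classic (x ord0 i)].

Lemma box_compact a b : compact (box a b).
Proof.
apply: (@rV_compact _ n (fun i => `[a i, b i]%classic)) => i.
exact: segment_compact.
Qed.

Lemma box_closed a b : closed (box a b).
Proof. by apply: compact_closed; [exact: norm_hausdorff|exact: box_compact]. Qed.

Lemma box_connected a b : connected (box a b).
Proof.
have [->|/set0P[x bx]] := eqVneq (box a b) set0; first exact: connected0.
pose S y := (fun t : R => x + t *: (y - x)) @` `[0, 1]%classic.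
have Sx y : S y x by exists 0; rewrite ?scale0r ?addr0//= in_itv/= lexx ler01.
have Sy y : S y y by exists 1; rewrite ?scale1r ?subrKC//= in_itv/= lexx ler01.
have -> : box a b = \bigcup_(y in box a b) S y.
  apply/seteqP; split => y; first by move=> ?; exists y.
  move=> [z bz [t /=]]; rewrite in_itv/= => /andP[t0 t1] <- i.
  have := bx i; have := bz i; rewrite /= !in_itv/= !mxE => /andP[? ?] /andP[? ?].
  apply/andP; split; nra.
apply: bigcup_connected; first by exists x => y _; exact: Sx.
move=> y _; apply: connected_continuous_connected.
  by apply/connected_intervalP; exact: interval_is_interval.
apply: continuous_subspaceT => t.
apply: cvgD; first exact: cvg_cst.
by apply: cvgZr_tmp; exact: cvg_id.
Qed.

Definition upd (a : 'I_n -> R) (i : 'I_n) (m : R) : 'I_n -> R :=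
  fun j => if j == i then m else a j.

Lemma box_split a b i m : a i <= m <= b i ->
  box a b = box a (upd b i m) `|` box (upd a i m) b.
Proof.
move=> /andP[am mb]; apply/seteqP; split => x.
  move=> bx; have [xm|/ltW mx] := leP (x ord0 i) m; [left|right] => j /=.
    have := bx j; rewrite /upd /= !in_itv/=; case: eqVneq => [->|//].
    by move=> /andP[-> _].
  have := bx j; rewrite /upd /= !in_itv/=; case: eqVneq => [->|//].
  by move=> /andP[_ ->]; rewrite mx.
case=> bx j; have := bx j; rewrite /upd/= !in_itv/=; case: eqVneq => [->|//].
  by move=> /andP[-> h]; exact: le_trans mb.
by move=> /andP[h ->]; rewrite (le_trans am).
Qed.

(** The two halves of a box meet in a flat box, hence in a connected set, as gluing requires. *)
Lemma box_updI a b i m : a i <= m <= b i ->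
  box a (upd b i m) `&` box (upd a i m) b = box (upd a i m) (upd b i m).
Proof.
move=> /andP[am mb]; apply/seteqP; split => x.
  move=> [h1 h2] j; move: (h1 j) (h2 j); rewrite /= /upd !in_itv/=.
  by case: eqVneq => [->|//] /andP[_ ->] /andP[->].
move=> h; split => j; have := h j; rewrite /= /upd !in_itv/=;
  case: eqVneq => [->|//] /andP[h1 h2]; rewrite ?h1 ?h2 ?andbT/=.
  exact: le_trans h1.
exact: le_trans h2 _.
Qed.

Context {G : groupType}.

(** Induction on the sum of the [c i], where [c i] bounds the number of slabs of width [d] needed in
    direction [i]. A direction with [c i > 1] allows one slab to be cut off; if there is none, the
    box is small. *)
Lemma box_potential (theta : 'rV[R]_n -> 'rV[R]_n -> G) (d : R)
    (c : 'I_n -> nat) a b : 0 < d ->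
  (forall a' b', box a' b' `<=` box a b -> (forall i, b' i - a' i <= d) ->
     exists s, potential theta (box a' b') s) ->
  (forall i, a i <= b i <= a i + d *+ c i) ->
  exists s, potential theta (box a b) s.
Proof.
move=> d0; have [N] := ubnP (\sum_i c i); elim: N c a b => // N IH c a b cN small ab.
have [c1|/forallPn[i]] := boolP [forall i, (c i <= 1)%N].
  apply: small => // i; rewrite lerBlDl.
  have /andP[_ /le_trans] := ab i; apply; rewrite lerD2l.
  have := forallP c1 i; case: (c i) => [_|[_|//]]; last by rewrite mulr1n.
  by rewrite mulr0n ltW.
rewrite -ltnNge => ci.
(* The minimum is needed because [c i] is only an upper bound: [a i + d] may lie beyond [b i]. *)
pose m := Num.min (b i) (a i + d).
have /andP[abi bai] := ab i.
have am : a i <= m by rewrite /m le_min abi; lra.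
have mb : m <= b i by rewrite /m ge_min lexx.
have amb : a i <= m <= b i by rewrite am.
have sumc (k : nat) : (k < c i)%N ->
    (\sum_j (if j == i then k else c j) < N)%N.
  move=> kc; move: cN; rewrite ltnS => /(leq_trans _); apply.
  rewrite (bigD1 i)//= eqxx [X in (_ < X)%N](bigD1 i)//= -addSn.
  by rewrite leq_add// leq_sum// => j /negPf ->.
have [s sP] : exists s, potential theta (box a (upd b i m)) s.
  apply: (IH (fun j => if j == i then 1%N else c j)); first exact: sumc.
    move=> a' b' h; apply: small; apply: subset_trans h _.
    by rewrite (box_split amb); exact: subsetUl.
  move=> j; rewrite /upd; case: eqVneq => [->|_]; last exact: ab.
  by rewrite am/= mulr1n /m ge_min lexx orbT.
have [s' s'P] : exists s, potential theta (box (upd a i m) b) s.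
  apply: (IH (fun j => if j == i then (c i).-1 else c j)).
  - by apply: sumc; rewrite prednK// (ltn_trans _ ci).
  - move=> a' b' h; apply: small; apply: subset_trans h _.
    by rewrite (box_split amb); exact: subsetUr.
  - move=> j; rewrite /upd; case: eqVneq => [->|_]; last exact: ab.
    rewrite mb/= /m; case: (leP (b i) (a i + d)) => _.
      by rewrite lerDl mulrn_wge0// ltW.
    by rewrite -addrA -mulrS prednK// (ltn_trans _ ci).
rewrite (box_split amb); apply: potential_glue sP s'P; try exact: box_closed.
  by rewrite box_updI//; exact: box_connected.
rewrite box_updI//; exists (\row_j upd a i m j) => j /=.
rewrite in_itv/= mxE lexx/= /upd; case: eqVneq => // _.
by have /andP[] := ab j.
Qed.

(** Potentials on an exhaustion by cubes, normalized at the origin, agree by uniqueness. *)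
Lemma rV_potential (theta : 'rV[R]_n -> 'rV[R]_n -> G) :
  (forall x, \forall y \near x, \forall z \near y,
     theta x z = (theta y z * theta x y)%g) ->
  exists s, potential theta setT s.
Proof.
move=> cocycle.
pose cube (k : nat) := box (fun=> - k%:R) (fun=> k%:R).
have cube0 k : cube k 0 by move=> i /=; rewrite in_itv/= mxE; have := ler0n R k; lra.
have cubeS (k l : nat) : (k <= l)%N -> cube k `<=` cube l.
  move=> kl x h i; have := h i; rewrite /= !in_itv/= => /andP[h1 h2].
  have : k%:R <= l%:R :> R by rewrite ler_nat.
  by move=> h3; apply/andP; split; lra.
have /choice[S SP] : forall k, exists s, potential theta (cube k) s /\ s 0 = 1%g.
  move=> k.
  suff [s sP] : exists s, potential theta (cube k) s.
    exists (fun x => (s 0)^-1 * s x)%g; split; last by rewrite mulVg.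
    exact: potentialMl.
  (* A Lebesgue number: one radius below which every ball centred in the cube carries a
     potential. *)
  have /compact_near_coveringP /(_ _ (0^'+) (fun d x =>
      exists s, potential theta (ball x d) s) _) : compact (cube k).
    exact: box_compact.
  case=> [x _|e /= e0 he].
    have [U /nbhs_ballP[e /= e0 eU] [s sU]] := cocycle_potential (cocycle x).
    have e20 : 0 < e / 2 by lra.
    exists (ball x (e / 2), [set d : R | d < e / 2]).
      by split; [exact: nbhsx_ballx|exact: nbhs_right_lt].
    move=> [y d] [/= xy de]; exists s; apply: potential_sub sU.
    apply: subset_trans eU => z yz; rewrite [e](splitr e).
    by apply: ball_triangle xy _; apply: le_ball yz; exact: ltW.
  (* A box of sides at most [e / 4] lies in the ball of radius [e / 2] around any of its points. The
     number of slabs is a truncated quotient, hence the successor. *)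
  pose d := e / 4; have d0 : 0 < d by rewrite /d; lra.
  apply: (@box_potential theta d (fun=> (Num.truncn (k%:R *+ 2 / d)).+1)) => //.
    move=> a' b' sub small.
    have [->|/set0P[x bx]] := eqVneq (box a' b') set0.
      by exists (fun=> 1%g) => x [].
    have [||s sP] := he (e / 2) _ _ x (sub _ bx); try by rewrite /=; lra.
      by rewrite /ball_ /= sub0r normrN ger0_norm; lra.
    exists s; apply: potential_sub sP => y yb; split=> [|i j]; first by lra.
    have -> : i = ord0 by apply/val_inj; case: i => -[].
    have := bx j; have := yb j; have := small j.
    rewrite /= /ball/= !in_itv/= /d => ? /andP[? ?] /andP[? ?].
    by rewrite real_ltr_norml ?num_real//; apply/andP; split; lra.
  move=> _; have k0 := ler0n R k; apply/andP; split; first by lra.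
  have : k%:R *+ 2 / d < (Num.truncn (k%:R *+ 2 / d)).+1%:R by exact: truncnS_gt.
  by rewrite ltr_pdivrMr// mulr_natl mulr2n => ?; lra.
have SE k l x : cube k x -> cube l x -> S k x = S l x.
  wlog kl : k l / (k <= l)%N => [hw kx lx|].
    by case/orP : (leq_total k l) => ?; [|symmetry]; apply: hw.
  move=> kx lx; have [[Sk Sk0] [Sl Sl0]] := (SP k, SP l).
  have := potential_unique (@box_connected _ _)
    (potential_sub (cubeS _ _ kl) Sl) Sk kx (cube0 k).
  by rewrite Sk0 Sl0 invg1 mulg1 => /(congr1 (fun g => g * S l x)%g); rewrite mulgVK mul1g.
have cube_near x : exists k, nbhs x (cube k).
  exists (\max_i (Num.truncn (`|x ord0 i| + 1)).+1)%N.
  apply/nbhs_ballP; exists 1 => //= y [_ xy] i.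
  have := xy ord0 i; rewrite /ball/= => h.
  have h2 : `|x ord0 i| + 1 < (\max_i (Num.truncn (`|x ord0 i| + 1)).+1)%N%:R.
    apply: lt_le_trans (truncnS_gt _) _; rewrite ler_nat.
    exact: (@leq_bigmax _ (fun i => (Num.truncn (`|x ord0 i| + 1)).+1)).
  rewrite in_itv/= -ler_norml.
  have : `|y ord0 i| <= `|x ord0 i| + `|x ord0 i - y ord0 i|.
    by rewrite distrC -{1}(subrKC (x ord0 i) (y ord0 i)) ler_normD.
  by move=> h3; lra.
have /choice[kk kkP] := cube_near.
(* The potential is read at [x] in a cube that is a neighborhood of [x], so that the same cube
   serves for all nearby points. *)
exists (fun x => S (kk x) x) => x _.
have [Sk _] := SP (kk x); have := Sk x (nbhs_singleton (kkP x)).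
have := kkP x; apply: filterS2 => y ky /(_ ky) <- _.
by rewrite (SE (kk y) (kk x))//; exact: nbhs_singleton (kkP y).
Qed.

End Box.

(** * The torus *)

Section TorusTopology.
Context (R : realType) (n : nat).
Local Notation M := (torus R n).

Definition torus_pi (x : 'rV[R]_n) : M := (\pi_(M) x)%qT.

Definition integral (z : 'rV[R]_n) : Prop := forall i, z ord0 i \is a Num.int.

Lemma torus_pi_eq x y : torus_pi x = torus_pi y <-> integral (x - y).
Proof.
split; first by move=> /eqmodP /forallP.
by move=> h; apply/eqmodP/forallP.
Qed.

Lemma torus_pi_surj p : exists x, torus_pi x = p.
Proof. by exists (generic_quotient.repr p); rewrite /torus_pi reprK. Qed.

Lemma torus_pi_continuous : continuous torus_pi.
Proof. exact: pi_continuous. Qed.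

Lemma torus_pi_add x z : integral z -> torus_pi (x + z) = torus_pi x.
Proof. by move=> hz; apply/torus_pi_eq; rewrite addrAC subrr add0r. Qed.

(** The projection is open: the saturation of an open set is the union of its integral
    translates. *)
Lemma torus_pi_nbhs x (U : set 'rV[R]_n) :
  nbhs x U -> nbhs (torus_pi x) (torus_pi @` U).
Proof.
rewrite nbhsE => -[V [oV Vx] VU].
rewrite nbhsE; exists (torus_pi @` V); last exact: image_subset.
split; last by exists x.
have oS : open (\bigcup_(z in integral) ((fun w => w + z) @^-1` V)).
  apply: bigcup_open => z _.
  have /continuousP : continuous (fun w : 'rV[R]_n => w + z).
    by move=> w; apply: (@cvgD _ _ _ (nbhs w)); [exact: cvg_id|exact: cvg_cst].
  exact.
rewrite /open/=/quotient_open; suff -> : (\pi_M @^-1` (torus_pi @` V))%qT =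
  \bigcup_(z in integral) ((fun w => w + z) @^-1` V) by [].
apply/seteqP; split => w /=.
  move=> [v Vv /torus_pi_eq vw]; exists (v - w) => //=.
  by rewrite subrKC.
move=> [z iz /= Vwz]; exists (w + z) => //; exact: torus_pi_add.
Qed.

Lemma torus_compact : compact [set: M].
Proof.
have -> : [set: M] = torus_pi @` box (fun=> 0) (fun=> 1).
  apply/seteqP; split => // p _.
  have [x <-] := torus_pi_surj p.
  exists (\row_i (x ord0 i - (Num.floor (x ord0 i))%:~R)).
    move=> i /=; rewrite mxE in_itv/=.
    have /andP[h1 h2] := floor_itv (x ord0 i).
    by rewrite intrD in h2; apply/andP; split; lra.
  apply/torus_pi_eq => i; rewrite !mxE addrAC subrr add0r rpredN.
  exact: intr_int.
apply: continuous_compact; last exact: box_compact.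
by apply: continuous_subspaceT; exact: torus_pi_continuous.
Qed.

Lemma torus_hausdorff : hausdorff_space M.
Proof.
move=> p q; have [x <-] := torus_pi_surj p; have [y <-] := torus_pi_surj q.
move=> cl; apply: contrapT => /torus_pi_eq /existsNP[i /negP nint].
set d := (x - y) ord0 i in nint.
have /andP[h1 h2] := floor_itv d; rewrite intrD in h2.
have h3 : (Num.floor d)%:~R < d.
  rewrite lt_neqAle h1 andbT; apply: contra nint => /eqP <-; exact: intr_int.
(* [e *+ 2] is the distance from [d] to the nearest integer. Moving [x] and [y] by less than [e]
   keeps the coordinate of their difference strictly between two consecutive integers. *)
pose e := Num.min (d - (Num.floor d)%:~R) ((Num.floor d)%:~R + 1 - d) / 2.
have [e1 e2] : e *+ 2 <= d - (Num.floor d)%:~R /\ e *+ 2 <= (Num.floor d)%:~R + 1 - d.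
  have -> : e *+ 2 = Num.min (d - (Num.floor d)%:~R) ((Num.floor d)%:~R + 1 - d).
    by rewrite /e mulr2n -splitr.
  by split; rewrite ge_min lexx ?orbT.
have e0 : 0 < e by rewrite /e divr_gt0// lt_min; apply/andP; split; lra.
have [_ [[u xu <-] [v yv /esym/torus_pi_eq/(_ i) uv]]] :=
  cl _ _ (torus_pi_nbhs (nbhsx_ballx x _ e0)) (torus_pi_nbhs (nbhsx_ballx y _ e0)).
have [_ /(_ ord0 i)] := xu; have [_ /(_ ord0 i)] := yv.
rewrite /ball/= !ltr_norml => /andP[a1 a2] /andP[a3 a4].
have /intrP[k Ek] := uv; move: Ek; rewrite !mxE => Ek.
have dE : d = x ord0 i - y ord0 i by rewrite /d !mxE.
have : (Num.floor d)%:~R < k%:~R :> R by rewrite -Ek; lra.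
have : k%:~R < (Num.floor d + 1)%:~R :> R by rewrite -Ek intrD; lra.
by rewrite !ltr_int ltzD1 leNgt => /negP.
Qed.

Lemma torus_locally_connected : locally_connected M.
Proof.
move=> p U; have [x <-] := torus_pi_surj p => /torus_pi_continuous /nbhs_ballP[e /= e0 eU].
pose C := box (fun i => x ord0 i - e / 2) (fun i => x ord0 i + e / 2).
exists (torus_pi @` C); last split.
- apply: torus_pi_nbhs; apply/nbhs_ballP; exists (e / 2); first by rewrite /=; lra.
  move=> y [_ xy] i; have := xy ord0 i; rewrite /ball/= in_itv/= ltr_norml => /andP[? ?].
  by apply/andP; split; lra.
- apply: connected_continuous_connected; first exact: box_connected.
  by apply: continuous_subspaceT; exact: torus_pi_continuous.
- move=> _ [y Cy <-]; apply: eU; split => // i j.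
  rewrite (ord1 i); have := Cy j; rewrite /ball/= in_itv/= ltr_norml => /andP[? ?].
  by apply/andP; split; lra.
Qed.

(** A potential of the lifted cocycle descends to a multivalued one: [sigma p] is the set of its
    values over [p], and [H] is the monodromy group, abelian because integral translations
    commute. *)
Lemma torus_potential (G : groupType) (theta : M -> M -> G) :
  (forall x, \forall y \near x, \forall z \near y,
     theta x z = (theta y z * theta x y)%g) ->
  exists (H : set G) (sigma : M -> set G),
    [/\ forall h h', H h -> H h' -> commute h h',
        forall x, sigma x !=set0,
        forall x g g', sigma x g -> sigma x g' -> H (g' * g^-1)%g &
        forall x, \forall y \near x, forall g,
          sigma y g <-> sigma x (g * theta x y)%g].
Proof.
move=> cocycle.
have [|s sP] := @rV_potential R n G (fun x y => theta (torus_pi x) (torus_pi y)).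
  move=> x; have h : nbhs x (torus_pi @^-1` [set y | \forall z \near y,
      theta (torus_pi x) z = (theta y z * theta (torus_pi x) y)%g]).
    exact: (torus_pi_continuous (cocycle (torus_pi x))).
  apply: filterS h => y /= h; exact: (torus_pi_continuous h).
(* The translate of a potential by an integral vector is a potential of the same lifted cocycle; by
   uniqueness it differs by a left factor. *)
have deck z : integral z -> exists h, forall x, s (x + z) = (h * s x)%g.
  move=> iz; exists (s (0 + z) * (s 0)^-1)%g => x.
  rewrite (@potential_unique _ _ _ setT s (fun x => s (x + z)) 0 x _ sP) //;
    first by rewrite mulgVK.
    suff -> : [set: 'rV[R]_n] = \bigcup_(k in [set: nat]) box (fun=> - k%:R) (fun=> k%:R).
      apply: bigcup_connected; last by move=> k _; exact: box_connected.
      by exists 0 => k _ i /=; rewrite in_itv/= mxE oppr_le0 ler0n.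
    apply/seteqP; split => // y _.
    exists (\max_i (Num.truncn `|y ord0 i|).+1)%N => // i.
    rewrite /= in_itv/= -ler_norml ltW//.
    apply: lt_le_trans (truncnS_gt _) _; rewrite ler_nat.
    exact: (@leq_bigmax _ (fun i => (Num.truncn `|y ord0 i|).+1)).
  move=> y _; have shift : (fun w : 'rV[R]_n => w + z) @ y --> y + z.
    by apply: (@cvgD _ _ _ (nbhs y)); [exact: cvg_id|exact: cvg_cst].
  have h : nbhs y ((fun w => w + z) @^-1` [set w | [set: 'rV[R]_n] w ->
      (s w * theta (torus_pi (y + z)) (torus_pi w))%g = s (y + z)]).
    exact: (shift _ (sP (y + z) I)).
  by apply: filterS h => w /= + _ => /(_ I); rewrite !torus_pi_add.
pose H := [set h | exists2 z, integral z & forall x, s (x + z) = (h * s x)%g].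
exists H, (fun p => s @` (torus_pi @^-1` [set p])); split.
- move=> h h' [z iz hz] [z' iz' hz'].
  have : s (0 + z + z') = s (0 + z' + z) by rewrite addrAC.
  by rewrite hz' hz hz hz' !mulgA => /mulIg e; rewrite /commute e.
- by move=> p; have [x xp] := torus_pi_surj p; exists (s x); exists x.
- move=> p _ _ [x /= xp <-] [y /= yp <-]; exists (y - x).
    by apply/torus_pi_eq; rewrite yp.
  have [h hP] : exists h, forall w, s (w + (y - x)) = (h * s w)%g.
    by apply/deck/torus_pi_eq; rewrite yp.
  by move=> w; have := hP x; rewrite subrKC => ->; rewrite mulgK.
(* The relation holds between [x] and a nearby lift [y]; the deck factors carry it to the other
   points of the two fibres. *)
- move=> p; have [x <-] := torus_pi_surj p.
  apply: filterS (torus_pi_nbhs (sP x I)) => _ [y + <-] g.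
  move=> /(_ I) sy; split.
    move=> [w /= /torus_pi_eq wy <-]; have [h hP] := deck _ wy.
    have := hP y; rewrite subrKC => ->.
    exists (x + (w - y)); first by rewrite /= torus_pi_add.
    by rewrite hP -mulgA sy.
  move=> [w /= wp]; have wx : integral (w - x) by apply/torus_pi_eq; rewrite wp.
  have [h hP] := deck _ wx.
  have := hP x; rewrite subrKC -sy mulgA => -> /mulIg <-.
  exists (y + (w - x)); first by rewrite /= torus_pi_add.
  by rewrite hP.
Qed.

(** Provides the nonabelian coefficients. *)
Lemma S3_noncommuting : exists a b : 'S_3, ~ commute a b.
Proof.
pose i0 : 'I_3 := ord0; pose i2 : 'I_3 := ord_max; pose i1 : 'I_3 := inord 1.
have n01 : i0 != i1 by rewrite -val_eqE /= inordK.
have n12 : i1 != i2 by rewrite -val_eqE /= inordK.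
exists (tperm i0 i1), (tperm i1 i2) => /permP /(_ i0).
rewrite !permM tpermL [tperm i1 i2 i0]tpermD ?tpermL//; last by rewrite eq_sym.
by move=> e; move: n12; rewrite -e eqxx.
Qed.

(* A group-valued cocycle on the torus equal to [a] on [O1], to [b] on [O2] and
   to [1] elsewhere near [K] has abelian monodromy; as [L1] (resp. [L2]) closes
   up to a loop crossing [O1] (resp. [O2]) once, [a] and [b] would commute. *)
Lemma torus_no_two_loops (K O1 O2 L1 L2 : set M) :
  connected K -> K !=set0 -> closed K -> O1 `&` O2 = set0 ->
  (forall x, K x -> \forall y \near x, ~ K y -> \forall z \near y,
     (O1 z <-> O1 y) /\ (O2 z <-> O2 y)) ->
  connected L1 -> L1 `&` K = set0 -> connected L2 -> L2 `&` K = set0 ->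
  (forall W, set_nbhs K W -> L1 `&` O1 `&` W !=set0) ->
  (forall W, set_nbhs K W -> L1 `&` ~` (O1 `|` O2) `&` W !=set0) ->
  (forall W, set_nbhs K W -> L2 `&` O2 `&` W !=set0) ->
  (forall W, set_nbhs K W -> L2 `&` ~` (O1 `|` O2) `&` W !=set0) ->
  False.
Proof.
move=> cK [k Kk] clK O12 germ cL1 L1K cL2 L2K in1 out1 in2 out2.
have [a [b nab]] := S3_noncommuting; apply: nab.
pose g y : 'S_3 := if `[< K y >] then 1%g else if `[< O1 y >] then a else
  if `[< O2 y >] then b else 1%g.
(* The germ of the cocycle is [g] at the points of [K] and trivial elsewhere: all the jumps take
   place on leaving [K]. *)
pose theta x y : 'S_3 := if `[< K x >] then g y else 1%g.
have nKnear y : ~ K y -> nbhs y (~` K).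
  by move=> Ky; apply: open_nbhs_nbhs; split => //; exact: closed_openC.
have disj (A B : set M) x : A `&` B = set0 -> A x -> ~ B x.
  by move=> AB Ax Bx; have : (A `&` B) x by []; rewrite AB.
have theta_nK x y : ~ K x -> theta x y = 1%g by move=> Kx; rewrite /theta asboolF.
have theta_K x y : K x -> theta x y = g y by move=> Kx; rewrite /theta asboolT.
have g_K y : K y -> g y = 1%g by move=> Ky; rewrite /g asboolT.
have cocycle x : \forall y \near x, \forall z \near y,
    theta x z = (theta y z * theta x y)%g.
  have [Kx|Kx] := pselect (K x); last first.
    have := nKnear x Kx; apply: filterS => y Ky; apply: filterE => z.
    by rewrite !theta_nK// mulg1.
  have := germ x Kx; apply: filterS => y gy.
  have [Ky|Ky] := pselect (K y).
    by apply: filterE => z; rewrite !theta_K// (g_K y Ky) mulg1.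
  have := gy Ky; have := nKnear y Ky; apply: filterS2 => z Kz [z1 z2].
  rewrite (theta_nK y)// mul1g !theta_K// /g !(asboolF Kz) !(asboolF Ky).
  by rewrite (asbool_equiv_eq z1) (asbool_equiv_eq z2).
have [H [sigma [Hcomm sigma0 Hsigma near_sigma]]] := torus_potential cocycle.
have sigmaK x : K x -> sigma x = sigma k.
  move=> Kx; apply: (locally_constant_connected cK) => // z Kz.
  have := near_sigma z; apply: filterS => w wz Kw; apply/seteqP.
  by split => h; rewrite wz theta_K// g_K// mulg1.
(* Near [K], passing from [sigma k] to [sigma y] is right multiplication by the inverse of [g y]. *)
pose W := [set y | forall h, sigma y h <-> sigma k (h * g y)%g].
have KW : set_nbhs K W.
  move=> x Kx; have := near_sigma x; apply: filterS => y yx h.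
  by rewrite yx sigmaK// theta_K.
(* Off [K] the cocycle is trivial, so [sigma] is constant along [L], and its two descriptions at [u]
   and at [v] must agree. *)
have crossing L u v : connected L -> L `&` K = set0 -> L u -> L v -> W u -> W v ->
    forall h, sigma k (h * g u)%g <-> sigma k (h * g v)%g.
  move=> cL LK Lu Lv Wu Wv h; rewrite -(Wu h) -(Wv h).
  suff -> : sigma u = sigma v by [].
  apply: (locally_constant_connected cL) => // z Lz.
  have Kz := disj _ _ _ LK Lz.
  have := near_sigma z; apply: filterS => w wz _; apply/seteqP.
  by split => h'; rewrite wz theta_nK// mulg1.
have gout v L : L `&` K = set0 -> L v -> (~` (O1 `|` O2)) v -> g v = 1%g.
  move=> LK Lv /not_orP[v1 v2]; rewrite /g asboolF; last exact: disj LK Lv.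
  by rewrite !asboolF.
have g1 u L : L `&` K = set0 -> L u -> O1 u -> g u = a.
  move=> LK Lu u1; rewrite /g asboolF; last exact: disj LK Lu.
  by rewrite asboolT.
have g2 u L : L `&` K = set0 -> L u -> O2 u -> g u = b.
  move=> LK Lu u2; rewrite /g asboolF; last exact: disj LK Lu.
  rewrite asboolF ?asboolT// => u1; exact: disj O12 u1 u2.
have [w kw] := sigma0 k.
have kwa : sigma k (w * a)%g.
  have [u [[Lu Ou] Wu]] := in1 W KW; have [v [[Lv Ov] Wv]] := out1 W KW.
  by rewrite -(g1 u L1)// (crossing L1 u v)// (gout v L1)// mulg1.
have kwb : sigma k (w * b)%g.
  have [u [[Lu Ou] Wu]] := in2 W KW; have [v [[Lv Ov] Wv]] := out2 W KW.
  by rewrite -(g2 u L2)// (crossing L2 u v)// (gout v L2)// mulg1.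
(* The conjugates of [a] and of [b] by the same [w] belong to [H], hence commute. *)
have := Hcomm _ _ (Hsigma _ _ _ kw kwa) (Hsigma _ _ _ kw kwb).
rewrite /commute !mulgA !mulgVK => /mulIg.
by rewrite -!mulgA => /mulgI.
Qed.

End TorusTopology.

(** * Flows and attraction *)

Section Components.
Context {M : topologicalType}.
Hypothesis lcM : locally_connected M.

Lemma component_near (A : set M) x y : open A -> A x ->
  \forall z \near x, connected_component A y z <-> connected_component A y x.
Proof.
move=> oA Ax; have [C Cx [cC CA]] := lcM (open_nbhs_nbhs (conj oA Ax)).
have Cxx := nbhs_singleton Cx.
apply: filterS Cx => z Cz.
have xz : connected_component A x z by exists C.
split => h; last exact: connected_component_trans h xz.
exact: connected_component_trans h (connected_component_sym xz).
Qed.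

Lemma finite_components (A Z : set M) : open A -> compact Z -> Z `<=` A ->
  (forall x, A x -> exists2 z, Z z & connected_component A x z) ->
  finite_set (components A).
Proof.
move=> oA cZ ZA meet.
(* Compactness along the filter of the sets of components containing a given finite set yields one
   finite set containing all the components that meet [Z]. *)
pose F : set_system (set (set M)) :=
  filter_from finite_set (fun D0 => [set D | D0 `<=` D]).
have FF : Filter F.
  apply: filter_from_filter; first by exists set0.
  move=> D D' fD fD'; exists (D `|` D'); first by rewrite finite_setU.
  by move=> E; rewrite /= subUset.
have /compact_near_coveringP /(_ _ F (fun D x => D (connected_component A x))) := cZ.
case=> [x /ZA Ax|D0 fD0 hD0].
  exists ([set y | connected_component A y = connected_component A x],
          [set D | [set connected_component A x] `<=` D]).
    split => /=; last by exists [set connected_component A x].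
    have := component_near x oA Ax; apply: filterS => y [_ h].
    by apply/esym/same_connected_component/h/connected_component_refl.
  by move=> [y D] [/= -> h]; exact: h.
apply: sub_finite_set fD0 => _ [x Ax <-]; have [z Zz xz] := meet x Ax.
by rewrite (same_connected_component xz); exact: (hD0 D0).
Qed.

(** A component of [P] missing [Q] is relatively open and closed in the union. *)
Lemma component_setU (P Q : set M) x y : open P -> open Q -> P x ->
  connected_component P x `&` Q = set0 ->
  connected_component (P `|` Q) x y -> connected_component P x y.
Proof.
move=> oP oQ Px xQ0 xy.
have nQ z : Q z -> ~ connected_component P x z.
  by move=> Qz xz; have : (connected_component P x `&` Q) z by []; rewrite xQ0.
have xx := connected_component_refl Px.
suff <- : connected_component P x x = connected_component P x y by [].
apply: (locally_constant_connected (@component_connected _ (P `|` Q) x)) => //.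
  move=> z xz; have [Pz|Qz] := connected_component_sub xz.
    by have := component_near x oP Pz; apply: filterS => w wz _; apply/propext.
  have := open_nbhs_nbhs (conj oQ Qz); apply: filterS => w Qw _; apply/propext.
  by split => h; [have := nQ _ Qw h|have := nQ _ Qz h].
by apply: connected_component_refl; left.
Qed.

End Components.

Section Flow.
Context {R : realType} {M : topologicalType}.
Implicit Types (phi : M -> R -> M) (K N V : set M) (x y : M).

(** Time reversal exchanges stable and unstable sets, so that each fact is proved in positive time
    only. *)
Definition rev_flow phi : M -> R -> M := fun x t => phi x (- t).

Lemma rev_flowK phi : rev_flow (rev_flow phi) = phi.
Proof. by apply/funext => x; apply/funext => t; rewrite /rev_flow opprK. Qed.

Definition forward_in phi N : set M :=
  [set x | forall s, 0 <= s -> N (phi x s)].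

Lemma positive_partE phi N x : is_flow phi ->
  positive_part phi N x <-> forward_in phi N x.
Proof.
move=> [_ phi0 _]; split.
  by move=> [_ h] s s0; apply: h; exists s => //; rewrite /= in_itv/= s0.
move=> h; split; first by rewrite -(phi0 x); exact: h.
by move=> _ [s /= + <-]; rewrite in_itv/= andbT; exact: h.
Qed.

Lemma negative_partE phi N x : is_flow phi ->
  negative_part phi N x <-> forward_in (rev_flow phi) N x.
Proof.
move=> [_ phi0 _]; split.
  by move=> [_ h] s s0; apply: h; exists (- s) => //; rewrite /= in_itv/= oppr_le0.
move=> h; split.
  by have := h 0 (lexx 0); rewrite /rev_flow oppr0 phi0.
move=> _ [s /= + <-]; rewrite in_itv/= => s0.
by have := h (- s); rewrite /rev_flow opprK oppr_ge0; apply.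
Qed.

Lemma rev_is_flow phi : is_flow phi -> is_flow (rev_flow phi).
Proof.
move=> [cphi phi0 phiD]; split.
- move=> p; rewrite /rev_flow.
  apply: (@continuous2_cvg _ _ _ _ (nbhs p) _ fst (fun q : M * R => - q.2) phi).
  - exact: (cphi (p.1, - p.2)).
  - exact: cvg_fst.
  - by apply: (@cvgN _ _ _ (nbhs p)); exact: cvg_snd.
- by move=> x; rewrite /rev_flow oppr0 phi0.
- by move=> x s t; rewrite /rev_flow phiD opprD.
Qed.

Lemma rev_isolating_nbhd phi K N :
  isolating_nbhd phi K N -> isolating_nbhd (rev_flow phi) K N.
Proof.
move=> [cN KN [KsN invK max]]; split => //; split => //.
  by move=> x t; exact: invK.
by move=> A AN invA; apply: max => // x t Ax; rewrite -[t]opprK; exact: invA.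
Qed.

Lemma rev_stable_set phi K : stable_set (rev_flow phi) K = unstable_set phi K.
Proof.
rewrite /stable_set /unstable_set.
suff E x : omega (rev_flow phi) x = omega_star phi x.
  by apply/seteqP; split => x /=; rewrite E.
rewrite /omega /omega_star; apply: eq_bigcapr => t _; congr closure.
apply/seteqP; split => _ [s /= + <-]; rewrite in_itv/= => st.
  by exists (- s) => //; rewrite /= in_itv/= lerN2; move: st => /andP[].
exists (- s); last by rewrite /rev_flow opprK.
by rewrite /= in_itv/= andbT lerNr.
Qed.

(** * Uniform attraction in an isolating neighborhood *)

Section Attraction.
Variables (phi : M -> R -> M) (K : set M).
Hypotheses (hphi : is_flow phi) (cM : compact [set: M]) (hM : hausdorff_space M).

Let psi := rev_flow phi.

Lemma flow_cont_time x : continuous (phi x).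
Proof.
case: hphi => cphi _ _ t.
apply: (@continuous2_cvg _ _ _ _ (nbhs t) _ (fun=> x) id phi).
- exact: (cphi (x, t)).
- exact: cvg_cst.
- exact: cvg_id.
Qed.

Lemma flow_cont t : continuous (phi^~ t).
Proof.
case: hphi => cphi _ _ x.
apply: (@continuous2_cvg _ _ _ _ (nbhs x) _ id (fun=> t) phi).
- exact: (cphi (x, t)).
- exact: cvg_id.
- exact: cvg_cst.
Qed.

Lemma flow0 x : phi x 0 = x. Proof. by case: hphi. Qed.

Lemma flowD x s t : phi (phi x s) t = phi x (s + t). Proof. by case: hphi. Qed.

Lemma flow_near t x U : nbhs (phi x t) U -> \forall y \near x, U (phi y t).
Proof. by move=> h; exact: (flow_cont h). Qed.

Lemma forward_in_closed N : closed N -> closed (forward_in phi N).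
Proof.
move=> cN x clx s s0; apply: contrapT => nN.
have /flow_near : nbhs (phi x s) (~` N).
  by apply: open_nbhs_nbhs; split => //; exact: closed_openC.
by move=> /clx [y [/(_ s s0)]].
Qed.

Lemma invariantP x t : invariant_set phi K -> K (phi x t) -> K x.
Proof. by move=> inv /(inv _ (- t)); rewrite flowD subrr flow0. Qed.

(** The full orbit of [x] is an invariant subset of [N], to which maximality applies. *)
Lemma isolating_both N x : isolating_nbhd phi K N ->
  forward_in phi N x -> forward_in psi N x -> K x.
Proof.
move=> [_ _ [_ _ max]] fx bx.
apply: (max [set phi x t | t in setT]).
- move=> _ [t _ <-]; have [t0|/ltW t0] := leP 0 t; first exact: fx.
  by have := bx (- t); rewrite /psi /rev_flow opprK oppr_ge0; apply.
- by move=> _ s [t _ <-]; exists (t + s) => //; rewrite flowD.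
- by exists 0 => //; rewrite flow0.
Qed.

Lemma isolating_nbhs N x : isolating_nbhd phi K N -> K x -> nbhs x N°.
Proof. by move=> [_ KN _] Kx; apply/nbhs_interior/KN. Qed.

Lemma isolating_closed N : isolating_nbhd phi K N -> closed N.
Proof. by move=> [cN _ _]; exact: compact_closed. Qed.

(* The decreasing compact sets [phi N^+ t] intersect in [K]. *)
Lemma uniform_attraction N W : isolating_nbhd phi K N -> set_nbhs K W ->
  exists T, forall x t, forward_in phi N x -> T <= t -> W (phi x t).
Proof.
move=> iN KW; have cN := isolating_closed iN; have [cptN KN _] := iN.
have cX : compact (N `&` ~` W°).
  apply: subclosed_compact cptN _ => //.
  by apply: closedI => //; exact/open_closedC/open_interior.
have /compact_near_coveringP /(_ R +oo%R
  (fun t x => ~ forward_in phi N (phi x (- t)))) := cX.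
case=> [x [Nx Wx]|T [_ hT]].
  (* Otherwise the full orbit of [x] would stay in [N], which would put [x] in [K], hence in the
     interior of [W]. *)
  have : ~ forward_in psi (forward_in phi N) x.
    move=> h; apply: Wx; apply: KW; apply: (isolating_both iN).
      by have := h 0 (lexx 0); rewrite /psi /rev_flow oppr0 flow0.
    by move=> s /h /(_ 0 (lexx 0)); rewrite flow0.
  move=> /existsNP[T /not_implyP[T0 /existsNP[s /not_implyP[s0 ns]]]].
  rewrite /psi /rev_flow flowD in ns.
  have /flow_near h : nbhs (phi x (- T + s)) (~` N).
    by apply: open_nbhs_nbhs; split => //; exact: closed_openC.
  exists ([set y | (~` N) (phi y (- T + s))], [set t | T <= t]).
    by split => //; exists T; split => [|t /ltW//]; exact: num_real.
  move=> [y t] [/= yN Tt] /(_ (t - T + s)).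
  rewrite flowD !addrA addNr add0r; move=> h'; apply: yN; apply: h'.
  by rewrite addr_ge0// subr_ge0.
exists (Num.max 0 (T + 1)) => x t fx; rewrite ge_max => /andP[t0 Tt].
apply: contrapT => nW.
apply: (hT t _ (phi x t)) => /=; first by lra.
  by split; [apply: fx; lra|move=> /interior_subset].
by rewrite flowD subrr flow0.
Qed.

End Attraction.
End Flow.

(** * The stable set of a non-saddle set, outside of that set *)

Section NonSaddle.
Context {R : realType} {M : topologicalType}.
Implicit Types (phi : M -> R -> M) (K N V W C D : set M) (x y : M).
Variables (phi : M -> R -> M) (K : set M).
Hypotheses (hphi : is_flow phi) (cM : compact [set: M]) (hM : hausdorff_space M)
  (lcM : locally_connected M) (clK : closed K).

Let psi := rev_flow phi.

Definition punctured_stable_set (phi : M -> R -> M) K : set M :=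
  stable_set phi K `\` K.

Local Notation P := (punctured_stable_set phi K).

(** An orbit leaving [N] at arbitrarily large times would have a limit point outside its interior,
    by compactness of the space. Conversely, if the orbit stays in [N] from some time on, so do the
    full orbits of its limit points. *)
Lemma stable_setP N x : isolating_nbhd phi K N ->
  stable_set phi K x <-> exists t, forward_in phi N (phi x t).
Proof.
move=> iN; have cN := isolating_closed hM iN; have [cptN KN [_ _ max]] := iN.
split=> [[_ omK]|[t0 ft0]].
  have cX : compact (~` N°).
    apply: subclosed_compact cM _ => //; exact/open_closedC/open_interior.
  have /compact_near_coveringP /(_ R +oo%R (fun t y => phi x t <> y)) := cX.
  case=> [y Ny|T [_ hT]].
    have : ~ omega phi x y by move=> /omK /KN.
    move=> /existsNP[t /not_implyP[/= t0 ncl]].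
    exists (~` closure (phi x @` `[t, +oo[), [set s | t <= s]).
      split => /=.
        by apply: open_nbhs_nbhs; split => //; exact/closed_openC/closed_closure.
      by exists t; split => [|s /ltW//]; exact: num_real.
    move=> [z s] [/= nz ts] xs; apply: nz; apply: subset_closure.
    by exists s => //; rewrite /= in_itv/= ts.
  exists (T + 1) => s s0; rewrite (flowD hphi).
  apply: contrapT => nN; apply: (hT (T + 1 + s) _ (phi x (T + 1 + s))) => //.
    by lra.
  by move=> /interior_subset.
split.
  have [y [_ cly]] := cM (F := phi x @ +oo) _ filterT.
  exists y => t /= _ U Uy.
  apply: cly => //; exists t; split => [|s ts]; first exact: num_real.
  by exists s => //; rewrite /= in_itv/= (ltW ts).
move=> y omy.
have inN r : N (phi y r).
  apply: contrapT => nN.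
  have /(flow_near hphi) h : nbhs (phi y r) (~` N).
    by apply: open_nbhs_nbhs; split => //; exact: closed_openC.
  have clo : closure (phi x @` `[Num.max 1 (t0 - r), +oo[) y.
    by apply: omy; rewrite /= lt_max ltr01.
  have [_ [[s sr <-] /=]] := clo _ h; apply.
  move: sr; rewrite /= in_itv/= andbT ge_max => /andP[_ sr].
  have -> : phi (phi x s) r = phi (phi x t0) (s + r - t0).
    by rewrite !(flowD hphi); congr (phi x _); lra.
  by apply: ft0; lra.
apply: (isolating_both hphi iN) => s _; exact: inN.
Qed.

Lemma stable_eventually x W : (exists N, isolating_nbhd phi K N) ->
  stable_set phi K x -> set_nbhs K W -> exists T, forall t, T <= t -> W (phi x t).
Proof.
move=> [N iN] /(stable_setP x iN)[t0 ft0] KW.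
have [T hT] := uniform_attraction hphi hM iN KW.
exists (t0 + T) => t Tt; rewrite -(subrKC t0 t) -(flowD hphi).
by apply: hT => //; lra.
Qed.

Hypothesis isoK : exists N, isolating_nbhd phi K N.

Lemma isolated_inv : invariant_set phi K.
Proof. by have [N [_ _ []]] := isoK. Qed.

Lemma flow_notin x t : ~ K x -> ~ K (phi x t).
Proof. by move=> nK /(invariantP hphi isolated_inv). Qed.

Lemma punctured_stable_flow x t : P x -> P (phi x t).
Proof.
move=> [sx nK]; split; last exact: flow_notin.
have [N iN] := isoK; move: sx => /(stable_setP _ iN)[t0 ft0].
by apply/(stable_setP _ iN); exists (t0 - t); rewrite (flowD hphi) subrKC.
Qed.

Lemma orbit_connected (I : set R) x : is_interval I -> connected (phi x @` I).
Proof.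
move=> iI; apply: connected_continuous_connected.
  exact/connected_intervalP.
by apply: continuous_subspaceT; exact: flow_cont_time.
Qed.

Lemma component_orbit x t : P x -> connected_component P x (phi x t).
Proof.
move=> Px; exists (phi x @` setT); last by exists t.
split; last by apply: orbit_connected.
  by exists 0 => //; rewrite flow0.
by move=> _ [s _ <-]; exact: punctured_stable_flow.
Qed.

(* [N = N^+ U N^-] is weakened to [V `<=` N^+ U N^-] for a smaller neighborhood [V],
   so that non-saddleness gives one without constructing any isolating block. *)
Definition quasi_block (phi : M -> R -> M) K N V : Prop :=
  [/\ isolating_nbhd phi K N, set_nbhs K V &
      forall x, V x -> forward_in phi N x \/ forward_in (rev_flow phi) N x].

(** Non-saddleness is applied to the neighborhood [U := N]. *)
Lemma nonsaddle_quasi_block : ~ saddle phi K -> exists N V, quasi_block phi K N V.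
Proof.
move=> ns; have [N iN] := isoK; exists N.
apply: contrapT => /forallNP nV; apply: ns; exists N; first by case: iN.
move=> V KV; have /not_and3P[//|//|/existsNP[x /not_implyP[Vx /not_orP[nf nb]]]] := nV V.
exists x; split => // h.
  by apply: nf => s s0; apply: h; exists s => //; rewrite /= in_itv/= s0.
apply: nb => s s0; apply: h; exists (- s) => //.
by rewrite /= in_itv/= oppr_le0.
Qed.

Lemma rev_quasi_block N V : quasi_block phi K N V -> quasi_block psi K N V.
Proof.
move=> [iN KV h]; split => //; first exact: rev_isolating_nbhd.
by move=> x /h; rewrite /psi rev_flowK => -[]; [right|left].
Qed.

Section Block.
Variables N V : set M.
Hypothesis qN : quasi_block phi K N V.

Let iN : isolating_nbhd phi K N. Proof. by case: qN. Qed.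
Let clN : closed N := isolating_closed hM iN.

Lemma not_forward_near x : ~ forward_in phi N x ->
  \forall y \near x, ~ forward_in phi N y.
Proof.
move=> nf; apply: open_nbhs_nbhs; split => //.
by apply: closed_openC; exact: (forward_in_closed hphi clN).
Qed.

Lemma not_backward_near x : ~ forward_in psi N x ->
  \forall y \near x, ~ forward_in psi N y.
Proof.
move=> nf; apply: open_nbhs_nbhs; split => //.
by apply: closed_openC; exact: (forward_in_closed (rev_is_flow hphi) clN).
Qed.

(** Off [K] a forward point is not a backward one. Not being backward is an open condition, and
    within [V] it implies being forward. *)
Lemma forward_near x : ~ K x -> forward_in phi N x -> nbhs x V ->
  \forall y \near x, forward_in phi N y.
Proof.
move=> nK fx Vx; have nb : ~ forward_in psi N x.
  by move=> bx; apply: nK; exact: isolating_both bx.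
have := not_backward_near nb; apply: filterS2 Vx => y Vy nby.
by have [_ _ /(_ y Vy)[]] := qN.
Qed.

Lemma notK_near x : ~ K x -> nbhs x (~` K).
Proof. by move=> nK; apply: open_nbhs_nbhs; split => //; exact: closed_openC. Qed.

Lemma set_nbhs_interior_block : set_nbhs K (V° `&` N°).
Proof.
have [_ KV _] := qN.
by move=> x Kx; apply: filterI; apply/nbhs_interior; [exact: KV|case: iN => _ + _; exact].
Qed.

Lemma open_punctured_stable_set : open P.
Proof.
rewrite openE => x Px; have [sx nK] := Px.
(* The orbit is followed until it is near [K], where [forward_near] applies; the neighborhood
   obtained there is pulled back by the flow. *)
have [T hT] := stable_eventually isoK sx set_nbhs_interior_block.
have /(flow_near hphi) : nbhs (phi x T) (forward_in phi N).
  apply: forward_near; first exact: flow_notin.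
    move=> s s0; rewrite (flowD hphi); apply: interior_subset.
    by have [|//] := hT (T + s); lra.
  by have [] := hT T (lexx T).
have := notK_near nK; apply: filterS2 => y nKy fy; split => //.
by apply/(stable_setP _ iN); exists T.
Qed.

(** The germ condition required by [torus_no_two_loops], for the part of [N^+] in one component of
    [P]. *)
Lemma germ_near x p : K x -> \forall y \near x, ~ K y -> \forall z \near y,
  (forward_in phi N `&` connected_component P p) z <->
  (forward_in phi N `&` connected_component P p) y.
Proof.
move=> Kx; have := set_nbhs_interior_block Kx; apply: filterS => y [Vy Ny] nKy.
have [fy|nfy] := pselect (forward_in phi N y); last first.
  by have := not_forward_near nfy; apply: filterS => z nfz; split => -[].
have Py : P y.
  by split => //; apply/(stable_setP _ iN); exists 0; rewrite flow0.
have := component_near lcM p open_punctured_stable_set Py.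
have := forward_near nKy fy Vy; apply: filterS2 => z fz zy.
by split => -[_ /zy].
Qed.

Lemma forward_meets x W : P x -> set_nbhs K W ->
  exists t, [/\ forward_in phi N (phi x t), connected_component P x (phi x t) &
                W (phi x t)].
Proof.
move=> Px KW; have [sx _] := Px; have [_ KN _] := iN.
have [T hT] := stable_eventually isoK sx (filterI KN KW).
exists T; split; [|exact: component_orbit|by case: (hT T (lexx T))].
by move=> s s0; rewrite (flowD hphi); have [] := hT (T + s); first lra.
Qed.

(* The exit points of [N^+] form a compact set meeting all the orbits of [P]. *)
Lemma finite_components_stable : finite_set (components P).
Proof.
apply: (@finite_components _ lcM P (forward_in phi N `&` ~` N°)).
- exact: open_punctured_stable_set.
- apply: (subclosed_compact _ cM) => //; apply: closedI.
    exact: forward_in_closed.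
  exact/open_closedC/open_interior.
- move=> x [fx nN]; split.
    by apply/(stable_setP _ iN); exists 0; rewrite flow0.
  by move=> /(isolating_nbhs iN)/nbhs_singleton.
move=> x Px; apply: contrapT => nmeet.
have fN t : forward_in phi N (phi x t) -> N° (phi x t).
  move=> ft; apply: contrapT => nN; apply: nmeet; exists (phi x t) => //.
  exact: component_orbit.
have [t0 [ft0 _ _]] := forward_meets Px (@filterT _ _ (set_nbhs_filter K)).
have fT (t : R) : forward_in phi N (phi x t).
  (* The times at which the orbit is in [N^+] form an open and closed set: a point of [N^+] in the
     interior of [N] is preceded by points of [N^+]. The full orbit then stays in [N], which
     contradicts that [x] is not in [K]. *)
  suff <- : forward_in phi N (phi x t0) = forward_in phi N (phi x t) by [].
  apply: (@locally_constant_connected R _ setT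
    (fun t => forward_in phi N (phi x t))) => //.
    by apply/connected_intervalP.
  move=> s _; have [fs|nfs] := pselect (forward_in phi N (phi x s)); last first.
    have h : nbhs s (phi x @^-1` [set y | ~ forward_in phi N y]).
      exact: (flow_cont_time hphi (not_forward_near nfs)).
    by apply: filterS h => r /= nfr _; apply/propext.
  have : nbhs s (phi x @^-1` N).
    by apply: (flow_cont_time hphi); apply: fN.
  move=> /nbhs_ballP[e /= e0 eN]; apply/nbhs_ballP; exists e => //= r sr _.
  apply/propext; split => // _ u u0; rewrite (flowD hphi).
  have [su|us] := leP s (r + u).
    by rewrite -(subrKC s (r + u)) -(flowD hphi); apply: fs; lra.
  apply: eN; move: sr; rewrite /ball/= !ltr_norml => /andP[? ?].
  by apply/andP; split; lra.
have [_ nK] := Px; apply: nK; apply: (isolating_both hphi iN) => s s0.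
  by rewrite -[x](flow0 hphi); exact: fT.
rewrite /psi/rev_flow; have := fT (- s) 0 (lexx 0).
by rewrite flow0.
Qed.

End Block.

End NonSaddle.

(** * Ends and homoclinic points *)

Lemma componentsE (M : topologicalType) (A C : set M) x :
  components A C -> C x -> C = connected_component A x.
Proof. by move=> [y Ay <-] /same_connected_component. Qed.

Section Ends.
Context {R : realType} {M : topologicalType}.

Definition quasi_block_components (phi : M -> R -> M) (K : set M) : set (set M) :=
  [set C | exists2 N, quasi_block phi K N N & components (N `\` K) C].

(** A single half-orbit is asked for; [forward_end_sub] extends this to all points of a block
    component. *)
Definition forward_end (phi : M -> R -> M) (C : set M) : Prop :=
  exists2 x, C x & forall s, 0 <= s -> C (phi x s).

Lemma block_components_quasi (phi : M -> R -> M) (K : set M) : is_flow phi ->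
  block_components phi K `<=` quasi_block_components phi K.
Proof.
move=> hphi C [N [[iN _] Npm] NC]; exists N => //.
split => //; first by case: iN.
move=> x; rewrite {1}Npm => -[/(positive_partE _ _ hphi)|/(negative_partE _ _ hphi)].
  by left.
by right.
Qed.

Lemma rev_quasi_block_components (phi : M -> R -> M) (K : set M) :
  quasi_block_components phi K `<=` quasi_block_components (rev_flow phi) K.
Proof. by move=> C [N qN NC]; exists N => //; exact: rev_quasi_block. Qed.

Lemma rev_end_related (phi : M -> R -> M) (C D : set M) :
  end_related phi C D -> end_related (rev_flow phi) C D.
Proof.
move=> [T h]; exists (- T) => _ [x Cx <-]; rewrite /rev_flow opprK.
by apply: h; exists x.
Qed.

Variables (phi : M -> R -> M) (K : set M).
Hypotheses (hphi : is_flow phi) (cM : compact [set: M]) (hM : hausdorff_space M)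
  (lcM : locally_connected M) (clK : closed K)
  (isoK : exists N, isolating_nbhd phi K N).

Let psi := rev_flow phi.
Local Notation P := (punctured_stable_set phi K).

Lemma forward_component (A : set M) x t s :
  (forall u, t <= u -> A (phi x u)) -> t <= s ->
  connected_component A (phi x t) (phi x s).
Proof.
move=> h ts; exists (phi x @` `[t, +oo[).
  split.
  - by exists t => //; rewrite /= in_itv/= lexx.
  - by move=> _ [u /= + <-]; rewrite in_itv/= andbT; exact: h.
  - by apply: orbit_connected => //; exact: interval_is_interval.
by exists s => //; rewrite /= in_itv/= ts.
Qed.

Lemma forward_in_notK N x s :
  ~ K x -> forward_in phi N x -> 0 <= s -> (N `\` K) (phi x s).
Proof. by move=> nK fx s0; split; [exact: fx|exact: (flow_notin hphi isoK)]. Qed.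

Lemma forward_in_end N C x : quasi_block phi K N N -> components (N `\` K) C ->
  C x -> forward_in phi N x -> forall s, 0 <= s -> C (phi x s).
Proof.
move=> qN NC Cx fx s s0; have CE := componentsE NC Cx.
have [_ nK] : (N `\` K) x by move: Cx; rewrite CE => /connected_component_sub.
rewrite CE -{1}(flow0 hphi x); apply: forward_component => // u u0.
exact: forward_in_notK.
Qed.

Lemma not_forward_end N C : quasi_block phi K N N -> components (N `\` K) C ->
  ~ forward_end phi C -> forward_end psi C.
Proof.
move=> qN NC nf; have [x Nx xC] := NC.
have Cx : C x by rewrite -xC; exact: connected_component_refl.
have [fx|bx] : forward_in phi N x \/ forward_in psi N x.
- by have [_ _] := qN; apply; case: Nx.
- by exfalso; apply: nf; exists x => //; exact: (forward_in_end qN).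
exists x => // s s0; have CE := componentsE NC Cx; rewrite CE.
have hpsi := rev_is_flow hphi.
exists (psi x @` `[0, +oo[); last by exists s => //; rewrite /= in_itv/= s0.
split.
- by exists 0; [rewrite /= in_itv/= lexx|exact: (flow0 hpsi)].
- move=> _ [u /= + <-]; rewrite in_itv/= andbT => u0.
  split; first exact: bx.
  by apply: (flow_notin hphi isoK); case: Nx.
- by apply: (orbit_connected hpsi); exact: interval_is_interval.
Qed.

(** On [N] minus [K] the forward and the backward conditions are closed, exclusive and exhaustive,
    so one of them holds throughout a component. *)
Lemma forward_end_sub N C : quasi_block phi K N N -> components (N `\` K) C ->
  forward_end phi C -> C `<=` forward_in phi N.
Proof.
move=> qN NC [x Cx fx] y Cy; have CE := componentsE NC Cx.
have CN : C `<=` N `\` K by rewrite CE; exact: connected_component_sub.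
have fNx : forward_in phi N x by move=> s s0; have [] := CN _ (fx s s0).
have iN : isolating_nbhd phi K N by case: qN.
suff <- : forward_in phi N x = forward_in phi N y by [].
apply: (@locally_constant_connected _ _ C) => //.
  by rewrite CE; exact: component_connected.
move=> z Cz; have [Nz nKz] := CN z Cz.
have [fz|nfz] := pselect (forward_in phi N z).
  have nb : ~ forward_in psi N z.
    by move=> bz; apply: nKz; exact: (isolating_both hphi iN).
  have := not_backward_near hphi hM qN nb; apply: filterS => w nbw Cw.
  apply/propext; split => // _.
  by have [_ _ /(_ w (CN w Cw).1)[|]] := qN.
have := not_forward_near hphi hM qN nfz.
by apply: filterS => w nfw _; apply/propext; split => // /nfw.
Qed.

Lemma forward_end_stable C : quasi_block_components phi K C ->
  forward_end phi C -> C `<=` P.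
Proof.
move=> [N qN NC] fC x Cx; have fx := forward_end_sub qN NC fC Cx.
have [_ nK] : (N `\` K) x.
  by move: Cx; have [y Ny <-] := NC; exact: connected_component_sub.
have iN : isolating_nbhd phi K N by case: qN.
by split => //; apply/(stable_setP hphi cM hM _ iN); exists 0; rewrite (flow0 hphi).
Qed.

Definition eventually_in (D : set M) : set M :=
  [set x | exists t, forall s, t <= s -> D (phi x s)].

(** At time [T], the orbits starting near [y] all cross a connected subset of [N^+] minus [K], so
    they end in the same component of [N] minus [K]. *)
Lemma eventually_in_near N D y : quasi_block phi K N N ->
  components (N `\` K) D -> P y ->
  \forall z \near y, eventually_in D z <-> eventually_in D y.
Proof.
move=> qN ND [sy nK]; have [iN KN _] := qN.
have [T hT] := stable_eventually hphi cM hM isoK sy (set_nbhs_interior_block qN).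
have fy : forward_in phi N (phi y T).
  move=> s s0; rewrite (flowD hphi); apply: interior_subset.
  by have [|//] := hT (T + s); lra.
have nKy : ~ K (phi y T) by exact: (flow_notin hphi isoK).
have Ny : nbhs (phi y T) N by have [] := hT T (lexx T).
have near_y : \forall z \near phi y T, forward_in phi N z /\ ~ K z.
  apply: filterS2 (forward_near hphi hM qN nKy fy Ny) (notK_near clK nKy).
  by move=> z; split.
have [B By [cB BS]] := lcM near_y.
have Byy := nbhs_singleton By.
have same z : B (phi z T) ->
    eventually_in D z <-> D = connected_component (N `\` K) (phi y T).
  move=> Bz; have [fz nKz] := BS _ Bz.
  have Ez s : T <= s -> connected_component (N `\` K) (phi y T) (phi z s).
    move=> Ts; apply: (@connected_component_trans _ _ (phi z T)).
      exists B => //; split => // w /BS[fw nKw]; split => //.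
      by rewrite -(flow0 hphi w); exact: fw.
    apply: forward_component => // u Tu; rewrite -(subrKC T u) -(flowD hphi).
    by apply: forward_in_notK => //; rewrite subr_ge0.
  split=> [[t ht]|->]; last by exists T.
  have Dm : D (phi z (Num.max t T)) by apply: ht; rewrite le_max lexx.
  have Em := Ez (Num.max t T); rewrite (componentsE ND Dm).
  by apply/esym/same_connected_component/Em; rewrite le_max lexx orbT.
have := flow_near hphi By; apply: filterS => z Bz.
exact: iff_trans (same z Bz) (iff_sym (same y Byy)).
Qed.

(* Two forward ends in one component of [P] eventually enter the same component
   [D]; by uniform attraction they do so at a uniform time. *)
Lemma forward_end_related C C' D x x' :
  quasi_block_components phi K C -> quasi_block_components phi K C' ->
  quasi_block_components phi K D ->
  forward_end phi C -> forward_end phi C' -> C x -> C' x' ->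
  connected_component P x x' -> end_related phi C D -> end_related phi C' D.
Proof.
move=> qC qC' [N qN ND] fC fC' Cx Cx' xx' [T CTD].
have CP := forward_end_stable qC fC; have C'P := forward_end_stable qC' fC'.
have [B qB BC] := qC; have [B' qB' B'C] := qC'.
have xD : eventually_in D x.
  exists T => s Ts; apply: CTD; exists (phi x (s - T)).
    apply: (forward_in_end qB BC Cx); last by rewrite subr_ge0.
    exact: (forward_end_sub qB BC fC).
  by rewrite (flowD hphi) subrK.
have C'D y : C' y -> eventually_in D y.
  move=> Cy; suff <- : eventually_in D x = eventually_in D y by [].
  apply: (locally_constant_connected (@component_connected _ P x)).
  - move=> z /connected_component_sub Pz.
    have := eventually_in_near qN ND Pz.
    by apply: filterS => w wz _; apply/propext.
  - by apply: connected_component_refl; exact: CP.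
  - apply: connected_component_trans xx' _; exists C' => //; split => //.
    by rewrite (componentsE B'C Cy); exact: component_connected.
have [iN KN _] := qN; have [iB' _ _] := qB'.
(* From the uniform time [T'] on, orbits from [C'] stay in [N] and off [K], hence in one component.
   Being in [D] later, they are already in [D] at time [T']. *)
have [T' hT'] := uniform_attraction hphi hM iB' KN.
exists T' => _ [y Cy <-]; have [t ht] := C'D y Cy.
have nKy : ~ K y by have [] := C'P y Cy.
have yT : connected_component (N `\` K) (phi y T') (phi y (Num.max t T')).
  apply: forward_component; last by rewrite le_max lexx orbT.
  move=> u Tu; split; last exact: (flow_notin hphi isoK).
  by apply: hT' => //; exact: (forward_end_sub qB' B'C fC').
have Dm : D (phi y (Num.max t T')) by apply: ht; rewrite le_max lexx.
by rewrite (componentsE ND Dm); exact: connected_component_sym.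
Qed.

End Ends.

(** * Gluing the components of two open sets *)

Section ComponentsUnion.
Context {M : topologicalType} (lcM : locally_connected M).

(** A component of [P] either misses [Q] and remains a component of the union, or contains points of
    the intersection, all of which share one component of [P]. *)
Lemma component_setU_left (P Q : set M) x y : open P -> open Q ->
  (forall h h', (P `&` Q) h -> (P `&` Q) h' ->
     connected_component P h = connected_component P h') ->
  P x -> P y -> connected_component (P `|` Q) x y -> connected_component P x y.
Proof.
move=> oP oQ hom Px Py xy.
have [Qx|/set0P[h [xh Qh]]] := eqVneq (connected_component P x `&` Q) set0.
  exact: component_setU Qx xy.
have [Qy|/set0P[h' [yh' Qh']]] := eqVneq (connected_component P y `&` Q) set0.
  apply: connected_component_sym; apply: (component_setU lcM oP oQ Py Qy).
  exact: connected_component_sym.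
rewrite (same_connected_component xh) (hom h h') -?(same_connected_component yh').
- exact: connected_component_refl.
- by split => //; exact: connected_component_sub xh.
- by split => //; exact: connected_component_sub yh'.
Qed.

(** If the component of [y] in [Q] missed [P], it would remain a component of the union and could
    not contain [x]. *)
Lemma component_setU_meet (P Q : set M) x y : open P -> open Q -> P x -> Q y ->
  connected_component (P `|` Q) x y ->
  exists2 h, (P `&` Q) h & connected_component Q y h.
Proof.
move=> oP oQ Px Qy xy.
have [Py|/set0P[h [yh Ph]]] := eqVneq (connected_component Q y `&` P) set0.
  exists x; last first.
    apply: (component_setU lcM oQ oP Qy Py); rewrite setUC.
    exact: connected_component_sym.
  split => //; have : connected_component Q y x.
    apply: (component_setU lcM oQ oP Qy Py); rewrite setUC.
    exact: connected_component_sym.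
  exact: connected_component_sub.
by exists h => //; split => //; exact: connected_component_sub yh.
Qed.

End ComponentsUnion.

(** The exceptional element accounts for the surplus of one. It need not belong to [A], which covers
    the case without exception. *)
Lemma card_le_inj_except (T U : Type) (A : set T) (B : set U) (e : T)
    (f : T -> U) (m : nat) : (B #= `I_m)%card -> (forall x, A x -> B (f x)) ->
  (forall x y, A x -> A y -> x <> e -> y <> e -> f x = f y -> x = y) ->
  exists2 k, (A #= `I_k)%card & (k <= m.+1)%N.
Proof.
move=> Bm AB inj.
have AeB : (A `\ e #<= B)%card.
  have finj : {in A `\ e &, injective f}.
    move=> x y; rewrite !inE => -[Ax xe] [Ay ye].
    exact: inj.
  have := inj_card_eq finj; rewrite card_eq_sym card_eq_le => /andP[h _].
  apply: card_le_trans h (subset_card_le _) => _ [x [Ax _] <-]; exact: AB.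
have /finite_setP[j Aj] : finite_set (A `\ e).
  by apply: card_le_finite AeB _; exists m.
have jm : (j <= m)%N.
  by rewrite -card_le_II -(card_le_eql Aj) -(card_le_eqr Bm).
have [Ae|nAe] := pselect (A e).
  by exists j.+1 => //; apply/eq_cardSP; exists e.
exists j; last exact: leqW.
suff -> : A = A `\ e by [].
apply/seteqP; split => x; last by case.
by move=> Ax; split => // xe; apply: nAe; rewrite -xe.
Qed.

(** * Homoclinic points on the torus *)

Section Homoclinic.
Context (R : realType) (n : nat).
Local Notation M := (torus R n).
Variables (phi : M -> R -> M) (K : set M).

Lemma homoclinic_component N V x y : is_flow phi -> connected K -> K !=set0 ->
  closed K -> quasi_block phi K N V ->
  (punctured_stable_set phi K `&` punctured_stable_set (rev_flow phi) K) x ->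
  (punctured_stable_set phi K `&` punctured_stable_set (rev_flow phi) K) y ->
  connected_component (punctured_stable_set phi K) x =
  connected_component (punctured_stable_set phi K) y.
Proof.
move=> hphi cK K0 clK qN Hx Hy; apply: contrapT => nxy.
have hpsi := rev_is_flow hphi.
have cM := @torus_compact R n; have hM := @torus_hausdorff R n.
have lcM : locally_connected M by exact: torus_locally_connected.
have [iN _ _] := qN.
have isoK : exists N, isolating_nbhd phi K N by exists N.
have isoK' : exists N, isolating_nbhd (rev_flow phi) K N.
  by exists N; exact: rev_isolating_nbhd.
set P := punctured_stable_set phi K in Hx Hy nxy *.
(* [O p] is the part of [N^+] through which [K] is entered from the component of [p], and the orbit
   [L p] is the arc that closes up through [K]. *)
pose O p := forward_in phi N `&` connected_component P p.
pose L p := phi p @` setT.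
have cL p : connected (L p) by exact: orbit_connected.
have LK p : (P `&` punctured_stable_set (rev_flow phi) K) p -> L p `&` K = set0.
  move=> [[_ nK] _]; apply/seteqP; split => // _ [[t _ <-]].
  exact: (flow_notin hphi isoK).
have Oin p W : (P `&` punctured_stable_set (rev_flow phi) K) p -> set_nbhs K W ->
    L p `&` O p `&` W !=set0.
  move=> [Pp _] KW.
  have [t [ft pt Wt]] := forward_meets hphi cM hM isoK qN Pp KW.
  by exists (phi p t); split => //; split => //; exists t.
have Oout p W : (P `&` punctured_stable_set (rev_flow phi) K) p -> set_nbhs K W ->
    L p `&` ~` (O x `|` O y) `&` W !=set0.
  move=> [_ Qp] KW.
  have [t [bt _ Wt]] := forward_meets hpsi cM hM isoK' (rev_quasi_block qN) Qp KW.
  (* Just after leaving [K], the orbit is in [N^-]; being off [K], it is not in [N^+], hence in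
     neither [O x] nor [O y]. *)
  exists (phi p (- t)); split => //; split; first by exists (- t).
  have [_ nK] := Qp => h; apply: (flow_notin hphi isoK (t := - t) nK).
  by apply: (isolating_both hphi iN) bt; case: h => -[].
apply: (@torus_no_two_loops R n K (O x) (O y) (L x) (L y)) => //.
- apply/seteqP; split => // z [[_ xz] [_ yz]]; apply: nxy.
  by rewrite (same_connected_component xz) (same_connected_component yz).
- move=> z Kz.
  apply: filterS2 (germ_near hphi cM hM lcM clK isoK qN x Kz)
    (germ_near hphi cM hM lcM clK isoK qN y Kz) => w wx wy nKw.
  by apply: filterS2 (wx nKw) (wy nKw) => v; split.
- exact: LK.
- exact: LK.
- by move=> W; exact: Oin.
- by move=> W; exact: Oout.
- by move=> W; exact: Oin.
- by move=> W; exact: Oout.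
Qed.

End Homoclinic.

(** * Counting the ends against the components *)

Theorem proposition3p9 (R : realType) (n : nat)
    (phi : torus R n -> R -> torus R n) (K : set (torus R n)) :
  is_flow phi ->
  isolated_invariant phi K ->
  connected K ->
  ~ saddle phi K ->
  exists2 c : int, is_complexity phi K c & c <= 1.
Proof.
move=> hphi [cptK _ K0 _ isoK] cK ns.
have hpsi := rev_is_flow hphi.
have cM := @torus_compact R n; have hM := @torus_hausdorff R n.
have lcM : locally_connected (torus R n) by exact: torus_locally_connected.
have clK : closed K by exact: compact_closed.
have [N [V qN]] := nonsaddle_quasi_block isoK ns.
have qN' := rev_quasi_block qN.
have isoK' : exists N, isolating_nbhd (rev_flow phi) K N.
  by exists N; case: qN'.
pose P := punctured_stable_set phi K; pose Q := punctured_stable_set (rev_flow phi) K.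
have oP : open P by exact: (open_punctured_stable_set hphi cM hM clK isoK qN).
have oQ : open Q by exact: (open_punctured_stable_set hpsi cM hM clK isoK' qN').
have homP h h' : (P `&` Q) h -> (P `&` Q) h' ->
    connected_component P h = connected_component P h'.
  exact: (homoclinic_component hphi cK K0 clK qN).
have homQ h h' : (Q `&` P) h -> (Q `&` P) h' ->
    connected_component Q h = connected_component Q h'.
  have := @homoclinic_component R n (rev_flow phi) K N V h h' hpsi cK K0 clK qN'.
  by rewrite rev_flowK.
have IPQ : region_of_influence phi K `\` K = P `|` Q.
  by rewrite /region_of_influence setDUl /P /Q /punctured_stable_set rev_stable_set.
have [m Im] : finite_set (components (P `|` Q)).
  have fP := finite_components_stable hphi cM hM lcM clK isoK qN.
  have fQ := finite_components_stable hpsi cM hM lcM clK isoK' qN'.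
  have fPQ : finite_set (components P `|` components Q) by rewrite finite_setU.
  (* Every component of the union is the saturation of a component of [P] or of [Q]. *)
  apply: sub_finite_set (finite_image
    (fun C => \bigcup_(x in C) connected_component (P `|` Q) x) fPQ).
  have comp A x : A `<=` P `|` Q -> A x ->
      \bigcup_(y in connected_component A x) connected_component (P `|` Q) y =
      connected_component (P `|` Q) x.
    move=> AI Ax; apply/seteqP; split => z.
      move=> [y xy yz]; apply: connected_component_trans yz.
      exists (connected_component A x) => //; split; last exact: component_connected.
        exact: connected_component_refl.
      exact: subset_trans (@connected_component_sub _ A x) AI.
    by move=> xz; exists x => //; exact: connected_component_refl.
  move=> _ [x PQx <-]; have [Px|Qx] := PQx.
    exists (connected_component P x); first by left; exists x.
    by apply: comp => //; exact: subsetUl.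
  exists (connected_component Q x); first by right; exists x.
  by apply: comp => //; exact: subsetUr.
pose class C := [set D | block_components phi K D /\ end_related phi C D].
have bq := block_components_quasi (K := K) hphi.
have rep E : exists C x, K_ends phi K E ->
    [/\ block_components phi K C, class C = E & C x].
  (* The values [set0] and [k] only make the choice total; they concern no actual end. *)
  have [[C bC CE]|nE] := pselect (K_ends phi K E); last first.
    by have [k _] := K0; exists set0, k.
  have [B _ [x Bx xC]] := bC; exists C, x => _; split => //.
  by rewrite -xC; exact: connected_component_refl.
have {rep} /choice[C /choice[pt repP]] := rep.
have forwardP E : K_ends phi K E -> forward_end phi (C E) -> P (pt E).
  move=> /repP[bC _ Cx] fC.
  exact: (forward_end_stable hphi cM hM (bq _ bC) fC).
have backward E : K_ends phi K E -> ~ forward_end phi (C E) ->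
    forward_end (rev_flow phi) (C E).
  by move=> /repP[/bq[B qB BC] _ _]; exact: (not_forward_end hphi isoK qB BC).
have backwardQ E : K_ends phi K E -> ~ forward_end phi (C E) -> Q (pt E).
  move=> KE nfC; have [bC _ Cx] := repP E KE.
  apply: (forward_end_stable hpsi cM hM _ (backward E KE nfC)) Cx.
  exact/rev_quasi_block_components/bq.
have sameP E E' : K_ends phi K E -> K_ends phi K E' ->
    forward_end phi (C E) -> forward_end phi (C E') ->
    connected_component P (pt E) (pt E') -> E = E'.
  move=> KE KE' f f' EE'.
  have [bC eE Cx] := repP E KE; have [bC' eE' Cx'] := repP E' KE'.
  suff : class (C E) = class (C E') by rewrite eE eE'.
  apply/seteqP; split => D [bD h]; split => //.
    exact: (forward_end_related hphi cM hM lcM clK isoK (bq _ bC) (bq _ bC')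
      (bq _ bD) f f' Cx Cx' EE' h).
  exact: (forward_end_related hphi cM hM lcM clK isoK (bq _ bC') (bq _ bC)
    (bq _ bD) f' f Cx' Cx (connected_component_sym EE') h).
have sameQ E E' : K_ends phi K E -> K_ends phi K E' ->
    ~ forward_end phi (C E) -> ~ forward_end phi (C E') ->
    connected_component Q (pt E) (pt E') -> E = E'.
  move=> KE KE' /(backward E KE) f /(backward E' KE') f' EE'.
  have [bC eE Cx] := repP E KE; have [bC' eE' Cx'] := repP E' KE'.
  suff : class (C E) = class (C E') by rewrite eE eE'.
  have rbq D : block_components phi K D ->
      quasi_block_components (rev_flow phi) K D.
    by move=> /bq; exact: rev_quasi_block_components.
  apply/seteqP; split => D [bD h]; split => //.
    rewrite -(rev_flowK phi); apply: rev_end_related.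
    exact: (forward_end_related hpsi cM hM lcM clK isoK' (rbq _ bC) (rbq _ bC')
      (rbq _ bD) f f' Cx Cx' EE' (rev_end_related h)).
  rewrite -(rev_flowK phi); apply: rev_end_related.
  exact: (forward_end_related hpsi cM hM lcM clK isoK' (rbq _ bC') (rbq _ bC)
    (rbq _ bD) f' f Cx' Cx (connected_component_sym EE') (rev_end_related h)).
(* The possible exception: all homoclinic points lie in one component of [Q], which by [sameQ]
   contains at most one non-forward end. If there is none, [set0] is an arbitrary default. *)
have [E0 E0P] : exists E0, forall E h, K_ends phi K E -> ~ forward_end phi (C E) ->
    (P `&` Q) h -> connected_component Q (pt E) h -> E = E0.
  have [[E0 [h0 [KE0 nf0 h0P E0h0]]]|none] := pselect (exists E0 h0,
      [/\ K_ends phi K E0, ~ forward_end phi (C E0), (P `&` Q) h0 &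
          connected_component Q (pt E0) h0]); last first.
    exists set0 => E h KE nf hP Eh; exfalso; apply: none.
    by exists E, h; split.
  exists E0 => E h KE nf hP Eh; apply: sameQ => //.
  rewrite (same_connected_component Eh) (homQ h h0); try by rewrite setIC.
  exact: connected_component_sym.
(* A forward and a non-forward end in one component of the union force a homoclinic point into the
   [Q]-component of the latter. *)
have mixed E E' : K_ends phi K E -> K_ends phi K E' ->
    forward_end phi (C E) -> ~ forward_end phi (C E') ->
    connected_component (P `|` Q) (pt E) (pt E') -> E' = E0.
  move=> KE KE' f nf' EE'.
  have [h hP E'h] := component_setU_meet lcM oP oQ (forwardP E KE f)
    (backwardQ E' KE' nf') EE'.
  exact: (E0P E' h).
have PQpt E : K_ends phi K E -> (P `|` Q) (pt E).
  move=> KE; have [f|nf] := pselect (forward_end phi (C E)).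
    by left; exact: forwardP.
  by right; exact: backwardQ.
(* Away from [E0], the component of the union containing [pt E] determines [E]. *)
have [k Kk km] : exists2 k, (K_ends phi K #= `I_k)%card & (k <= m.+1)%N.
  apply: (card_le_inj_except (e := E0) Im
    (f := fun E => connected_component (P `|` Q) (pt E))).
    by move=> E KE; exists (pt E) => //; exact: PQpt.
  move=> E E' KE KE' nE nE' FE.
  have EE' : connected_component (P `|` Q) (pt E) (pt E').
    by rewrite FE; apply/connected_component_refl/PQpt.
  have [f|nf] := pselect (forward_end phi (C E));
    have [f'|nf'] := pselect (forward_end phi (C E')).
  - apply: sameP => //.
    by apply: (component_setU_left lcM oP oQ homP) => //; exact: forwardP.
  - by exfalso; apply: nE'; exact: (mixed E).
  - by exfalso; apply: nE; exact: (mixed E' E KE' KE f' nf (connected_component_sym EE')).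
  - apply: sameQ => //.
    apply: (component_setU_left lcM oQ oP homQ); try exact: backwardQ.
    by rewrite setUC.
exists (k%:Z - m%:Z); first by exists k, m; rewrite IPQ.
by rewrite lerBlDr -PoszD lez_nat add1n.
Qed.
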